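(* Let $M$ be a proper monomial ideal with $n$ minimal generators in a polynomial ring over a field, let $P_M$ be its LCM lattice, and let $P$ be the underlying abstract finite atomic lattice of $P_M$, where for $p\in P$ the corresponding monomial in $P_M$ is denoted $\overline{p}$. Let $\mathcal{D}=\{m_p\}_{p\in P}$ be the labeling of $P$ given by $$m_p=\frac{\gcd\{\overline{t} : t\in P,\ t>p\}}{\overline{p}},$$ where for $p=\hat 1$ the gcd is defined to be $\overline{\hat 1}$. Then $\mathcal{D}$ is a coordinatization of $P$, and the resulting monomial ideal satisfies $M_{P,\mathcal{D}}=M$.
   Context: The LCM lattice $P_M$ of a monomial ideal $M$ is the set of least common multiples of all subsets of its minimal monomial generators (with $1$ the lcm of the empty set), ordered by divisibility. $P=\{p : \overline{p}\in P_M\}$ is ordered by $p<p'$ if and only if $\overline{p}<\overline{p'}$ in $P_M$ (i.e. one forgets the monomials). A finite atomic lattice is a finite lattice (with minimum $\hat 0$ and maximum $\hat 1$) in which every element other than $\hat 0$ is a join of atoms, an atom being an element covering $\hat 0$. For $x\in P$ put $\lceil x\rceil=\{a\in P : x\le a\}$ and $\lceil x\rceil^c=P\setminus\lceil x\rceil$. A labeling of $P$ is a family $\mathcal{M}=\{m_p\}_{p\in P}$ of monomials ($m_p=1$ meaning that $p$ is unlabeled). Given a labeling $\mathcal{M}$, $M_{P,\mathcal{M}}$ is the monomial ideal generated by the monomials $x(a)=\prod_{p\in\lceil a\rceil^c}m_p$ for the atoms $a$ of $P$. A labeling $\mathcal{M}$ is a coordinatization of $P$ if the LCM lattice of $M_{P,\mathcal{M}}$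 is isomorphic to $P$. *)

(* Defs.v *)
From HB Require Import structures.
From mathcomp Require Import all_boot all_order all_algebra.
From mathcomp Require Export mpoly.

Set Implicit Arguments.
Unset Strict Implicit.
Unset Printing Implicit Defensive.

Import Order.TTheory GRing.Theory.
Local Open Scope ring_scope.

(* A monomial is its exponent vector ('X_{1..r}), so 0%MM is the monomial 1,
   (m1 + m2)%MM the product, (m1 - m2)%MM the quotient (truncated when m2 does
   not divide m1) and (m1 <= m2)%MM, (m1 < m2)%MM are (proper) divisibility.
   The canonical order %O on 'X_{1..r} is a monomial order, not divisibility. *)

Section Monomials.
Variable r : nat.

Definition mgcd (m1 m2 : 'X_{1..r}) : 'X_{1..r} :=
  [multinom minn (m1 i) (m2 i) | i < r].

Definition lcm_seq (S : seq 'X_{1..r}) : 'X_{1..r} :=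
  \big[@mlcm r/0%MM]_(g <- S) g.

End Monomials.

Section MonomialIdeals.
Variables (k : fieldType) (r : nat).

(* Ideals are Prop-valued predicates, compared extensionally. *)
Definition same_ideal (I J : {mpoly k[r]} -> Prop) : Prop :=
  forall f, I f <-> J f.

Definition ideal_gen (S : 'X_{1..r} -> Prop) (f : {mpoly k[r]}) : Prop :=
  exists c : seq ({mpoly k[r]} * 'X_{1..r}),
    (forall t, t \in c -> S t.2) /\ f = \sum_(t <- c) t.1 * 'X_[t.2].

Definition monomial_ideal (I : {mpoly k[r]} -> Prop) : Prop :=
  exists S : 'X_{1..r} -> Prop, same_ideal I (ideal_gen S).

(* By monotonicity it is enough to remove one generator at a time. *)
Definition minimal_generators (I : {mpoly k[r]} -> Prop)
    (G : seq 'X_{1..r}) : Prop :=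
  [/\ uniq G,
      same_ideal I (ideal_gen (fun g => g \in G))
    & forall g, g \in G ->
        ~ same_ideal I (ideal_gen (fun h => h \in rem g G))].

(* The minimal generators are unique up to order (minimal_generators_uniq). *)
Definition in_lcm_lattice (I : {mpoly k[r]} -> Prop) (m : 'X_{1..r}) : Prop :=
  exists G S : seq 'X_{1..r},
    [/\ minimal_generators I G, {subset S <= G} & m = lcm_seq S].

End MonomialIdeals.

Section Lattices.
Variables (d : Order.disp_t) (P : finTBLatticeType d).

Definition atom (a : P) : Prop :=
  (\bot < a)%O /\ forall x : P, ~ ((\bot < x)%O /\ (x < a)%O).

Definition atomic_lattice : Prop :=
  forall x : P, x <> \bot%O ->
  exists A : {set P},
    (forall a, a \in A -> atom a) /\ x = (\join_(a in A) a)%O.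

Section Labelings.
Variables (k : fieldType) (r : nat).

(* For x : P, bar x is the monomial written with an overline. *)
Definition lcm_lattice_iso (I : {mpoly k[r]} -> Prop) (bar : P -> 'X_{1..r})
    : Prop :=
  [/\ injective bar,
      forall m, in_lcm_lattice I m <-> exists p, bar p = m
    & forall p q : P, (p <= q)%O = (bar p <= bar q)%MM].

Definition atom_monomial (m : P -> 'X_{1..r}) (a : P) : 'X_{1..r} :=
  (\sum_(p : P | ~~ (a <= p)%O) m p)%MM.

Definition labeling_ideal (m : P -> 'X_{1..r}) : {mpoly k[r]} -> Prop :=
  ideal_gen (fun x => exists a, atom a /\ x = atom_monomial m a).

Definition coordinatization (m : P -> 'X_{1..r}) : Prop :=
  exists bar : P -> 'X_{1..r}, lcm_lattice_iso (labeling_ideal m) bar.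

End Labelings.

(* For p <> \top the element \top is among the t > p, so starting the fold at
   bar \top changes nothing; for p = \top the fold is empty and its value is
   bar \top.  The subtraction is exact, as bar p divides bar t for t > p. *)
Definition gcd_labeling (r : nat) (bar : P -> 'X_{1..r}) (p : P) : 'X_{1..r} :=
  (\big[@mgcd r/bar \top%O]_(t : P | (p < t)%O) bar t - bar p)%MM.

End Lattices.

(* Uniqueness of the minimal generators; lcm_lattice_exists: a finite lattice P
   with an isomorphism bar onto the LCM lattice exists; lcm_lattice_atomic: any
   such P is atomic, so assuming atomicity of P loses no generality. *)

Section LcmSeq.
Variable r : nat.
Implicit Types (m : 'X_{1..r}) (S G : seq 'X_{1..r}).

Lemma lepm_anti m1 m2 : (m1 <= m2)%MM -> (m2 <= m1)%MM -> m1 = m2.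
Proof.
move=> /mnm_lepP h1 /mnm_lepP h2; apply/mnmP => i; apply/eqP.
by rewrite eqn_leq h1 h2.
Qed.

Lemma lcm_seq_le S m : (lcm_seq S <= m)%MM = all (fun g => (g <= m)%MM) S.
Proof.
rewrite /lcm_seq; elim: S => [|g S IH] /=.
  by rewrite big_nil; apply/mnm_lepP => i; rewrite mnm0E.
by rewrite big_cons lem_mlcm IH.
Qed.

Lemma le_lcm_seq S g : g \in S -> (g <= lcm_seq S)%MM.
Proof.
by move=> gS; move: (lepm_refl (lcm_seq S)); rewrite lcm_seq_le => /allP; apply.
Qed.

Lemma lcm_seq_sub S G : {subset S <= G} -> (lcm_seq S <= lcm_seq G)%MM.
Proof. by move=> h; rewrite lcm_seq_le; apply/allP => g /h/le_lcm_seq. Qed.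

Definition divisors_in G m := [seq g <- G | (g <= m)%MM].

Lemma lcm_divisors_in_le G m : (lcm_seq (divisors_in G m) <= m)%MM.
Proof. by rewrite lcm_seq_le filter_all. Qed.

Lemma lcm_divisors_inE S G : {subset S <= G} ->
  lcm_seq (divisors_in G (lcm_seq S)) = lcm_seq S.
Proof.
move=> h; apply: lepm_anti; first exact: lcm_divisors_in_le.
by apply: lcm_seq_sub => g gS; rewrite mem_filter le_lcm_seq ?h.
Qed.

End LcmSeq.

Section MinimalGenerators.
Variables (k : fieldType) (r : nat).
Implicit Types (I : {mpoly k[r]} -> Prop) (G : seq 'X_{1..r}).

Lemma ideal_gen_support (S : 'X_{1..r} -> Prop) (f : {mpoly k[r]}) m :
  ideal_gen S f -> m \in msupp f -> exists2 s, S s & (s <= m)%MM.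
Proof.
case=> c [cS ->]; elim: c cS => [|t c IH] cS.
  by rewrite big_nil msupp0.
rewrite big_cons => /msuppD_le; rewrite mem_cat => /orP[|].
  move/msuppM_le/allpairsP => [[m1 m2] /= [_]]; rewrite msuppX inE.
  by move=> /eqP-> ->; exists t.2; [apply: cS; rewrite mem_head|exact: lem_addl].
by apply: IH => u uc; apply: cS; rewrite in_cons uc orbT.
Qed.

Lemma ideal_gen_monomial (S : 'X_{1..r} -> Prop) m :
  ideal_gen S ('X_[m] : {mpoly k[r]}) <-> exists2 s, S s & (s <= m)%MM.
Proof.
split=> [h|[s Ss sm]]; first by apply: (ideal_gen_support h); rewrite msuppX inE.
exists [:: ('X_[(m - s)%MM], s)]; split=> [t|].
  by rewrite inE => /eqP->.
by rewrite big_seq1 /= -mpolyXD submK.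
Qed.

Lemma ideal_gen_sub (S T : 'X_{1..r} -> Prop) (f : {mpoly k[r]}) :
  (forall s, S s -> exists2 t, T t & (t <= s)%MM) ->
  ideal_gen S f -> ideal_gen T f.
Proof.
move=> ST [c [cS ->]]; elim: c cS => [|u c IH] cS.
  by exists [::]; split=> //; rewrite !big_nil.
have [|c' [c'T E]] := IH; first by move=> v vc; apply: cS; rewrite in_cons vc orbT.
have [t Tt tu] := ST _ (cS u (mem_head _ _)).
exists ((u.1 * 'X_[(u.2 - t)%MM], t) :: c'); split=> [v|].
  by rewrite in_cons => /orP[/eqP->|/c'T].
by rewrite !big_cons E /= -mulrA -mpolyXD submK.
Qed.

Lemma minimal_generators_antichain I G g h : minimal_generators I G ->
  g \in G -> h \in G -> (g <= h)%MM -> g = h.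
Proof.
case=> uG IG Gmin gG hG gh; apply/eqP/negPn/negP => ngh; apply: (Gmin h hG) => f.
split=> [/IG|hf].
  apply: ideal_gen_sub => s sG; have [->|nsh] := eqVneq s h.
    by exists g => //; rewrite mem_rem_uniq // inE ngh.
  by exists s; [rewrite mem_rem_uniq // inE nsh | exact: lepm_refl].
apply/IG; apply: ideal_gen_sub hf => s /mem_rem sG; exists s => //.
exact: lepm_refl.
Qed.

Lemma minimal_generators_uniq I G G' :
  minimal_generators I G -> minimal_generators I G' -> G =i G'.
Proof.
suff H: forall A B, minimal_generators I A -> minimal_generators I B ->
    {subset A <= B}.
  by move=> hG hG' g; apply/idP/idP; apply: H.
move=> A B hA hB g gA; case: (hA) (hB) => _ IA _ [_ IB _].
have /IA/IB/ideal_gen_monomial[b bB bg] :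
    ideal_gen (fun g => g \in A) ('X_[g] : {mpoly k[r]}).
  by apply/ideal_gen_monomial; exists g => //; exact: lepm_refl.
have /IB/IA/ideal_gen_monomial[a aA ab] :
    ideal_gen (fun g => g \in B) ('X_[b] : {mpoly k[r]}).
  by apply/ideal_gen_monomial; exists b => //; exact: lepm_refl.
have ag := minimal_generators_antichain hA aA gA (lepm_trans ab bg).
by rewrite (@lepm_anti _ g b) // -ag.
Qed.

Lemma in_lcm_latticeP I G m : minimal_generators I G ->
  in_lcm_lattice I m <-> m = lcm_seq (divisors_in G m).
Proof.
move=> hG; split=> [[G' [S [hG' SG' ->]]]|E].
  by rewrite lcm_divisors_inE // => g /SG'; rewrite (minimal_generators_uniq hG hG').
by exists G, (divisors_in G m); split=> // g; rewrite mem_filter => /andP[].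
Qed.

End MinimalGenerators.

Section Existence.
Variables (r : nat) (G : seq 'X_{1..r}).

Definition lcm_enum : seq 'X_{1..r} :=
  [seq lcm_seq (mask b G) | b : (size G).-tuple bool].

Lemma lcm_enumP m : (m \in lcm_enum) = (m == lcm_seq (divisors_in G m)).
Proof.
apply/imageP/eqP => [[b _ ->]|E].
  by rewrite lcm_divisors_inE // => g; exact: mem_mask.
exists [tuple of map (fun g => (g <= m)%MM) (in_tuple G)] => //=.
by rewrite {1}E /divisors_in filter_mask.
Qed.

Definition lcm_type : Type := seq_sub lcm_enum.
HB.instance Definition _ := Finite.on lcm_type.

Definition lcm_le (x y : lcm_type) := (ssval x <= ssval y)%MM.

Lemma lcm_le_refl : reflexive lcm_le.
Proof. by move=> x; exact: lepm_refl. Qed.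

Lemma lcm_le_anti : antisymmetric lcm_le.
Proof. by move=> x y /andP[h1 h2]; apply: val_inj; exact: lepm_anti. Qed.

Lemma lcm_le_trans : transitive lcm_le.
Proof. by move=> y x z; exact: lepm_trans. Qed.

Fact lcm_display : Order.disp_t.
Proof. exact: Order.Disp tt tt. Qed.

HB.instance Definition _ := Order.Le_isPOrder.Build
  lcm_display lcm_type lcm_le_refl lcm_le_anti lcm_le_trans.

Lemma lcm_typeE (x : lcm_type) : ssval x = lcm_seq (divisors_in G (ssval x)).
Proof. by apply/eqP; rewrite -lcm_enumP ssvalP. Qed.

Lemma lcm_of_proof S : lcm_seq (divisors_in G S) \in lcm_enum.
Proof.
by rewrite lcm_enumP lcm_divisors_inE // => g; rewrite mem_filter => /andP[].
Qed.

(* The largest element of the LCM lattice dividing a monomial. *)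
Definition lcm_of m : lcm_type := SeqSub (lcm_of_proof m).

Lemma le_lcm_of (x : lcm_type) m : lcm_le x (lcm_of m) = (ssval x <= m)%MM.
Proof.
apply/idP/idP => [h|h]; first exact: lepm_trans h (lcm_divisors_in_le G m).
rewrite /lcm_le lcm_typeE; apply: lcm_seq_sub => g; rewrite !mem_filter.
by case/andP=> gx ->; rewrite (lepm_trans gx h).
Qed.

Definition lcm_meet (x y : lcm_type) := lcm_of (mgcd (ssval x) (ssval y)).

Lemma lcm_lexI x y z : lcm_le x (lcm_meet y z) = lcm_le x y && lcm_le x z.
Proof.
rewrite le_lcm_of /lcm_le; apply/mnm_lepP/andP => [h|[/mnm_lepP hy /mnm_lepP hz] i].
  by split; apply/mnm_lepP => i; have:= h i; rewrite mnmE leq_min => /andP[].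
by rewrite mnmE leq_min hy hz.
Qed.

Definition lcm_join (x y : lcm_type) := lcm_of (mlcm (ssval x) (ssval y)).

Lemma lcm_leUx x y z : lcm_le (lcm_join x y) z = lcm_le x z && lcm_le y z.
Proof.
apply/idP/andP => [h|[hx hy]].
  split; apply: lcm_le_trans h; rewrite le_lcm_of.
  - exact: lem_mlcml.
  - exact: lem_mlcmr.
apply: lepm_trans (lcm_divisors_in_le G _) _.
by rewrite lem_mlcm; apply/andP.
Qed.

HB.instance Definition _ :=
  Order.POrder_isMeetSemilattice.Build lcm_display lcm_type lcm_lexI.
HB.instance Definition _ :=
  Order.POrder_isJoinSemilattice.Build lcm_display lcm_type lcm_leUx.

Lemma lcm_le0x (x : lcm_type) : lcm_le (lcm_of 0%MM) x.
Proof.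
apply: lepm_trans (lcm_divisors_in_le G 0%MM) _.
by apply/mnm_lepP => i; rewrite mnm0E.
Qed.

Lemma lcm_lex1 (x : lcm_type) : lcm_le x (lcm_of (lcm_seq G)).
Proof.
rewrite le_lcm_of lcm_typeE; apply: lcm_seq_sub => g.
by rewrite mem_filter => /andP[].
Qed.

HB.instance Definition _ :=
  Order.hasBottom.Build lcm_display lcm_type lcm_le0x.
HB.instance Definition _ :=
  Order.hasTop.Build lcm_display lcm_type lcm_lex1.

End Existence.

Lemma lcm_lattice_exists (k : fieldType) (r : nat)
    (I : {mpoly k[r]} -> Prop) (G : seq 'X_{1..r}) :
  minimal_generators I G ->
  exists (d : Order.disp_t) (P : finTBLatticeType d) (bar : P -> 'X_{1..r}),
    lcm_lattice_iso I bar.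
Proof.
move=> hG; exists lcm_display, (lcm_type G : finTBLatticeType _), (@ssval _ _).
split=> [|m|//]; first exact: val_inj.
rewrite (in_lcm_latticeP m hG); split=> [/eqP|[x <-]]; last exact: lcm_typeE.
by rewrite -lcm_enumP => mP; exists (SeqSub mP).
Qed.

Lemma lcm_lattice_atomic (k : fieldType) (r : nat)
    (I : {mpoly k[r]} -> Prop) (G : seq 'X_{1..r})
    (d : Order.disp_t) (P : finTBLatticeType d) (bar : P -> 'X_{1..r}) :
  minimal_generators I G -> lcm_lattice_iso I bar -> atomic_lattice P.
Proof.
move=> hG [_ barE barle] x _.
have barP y : bar y = lcm_seq (divisors_in G (bar y)).
  by apply/(in_lcm_latticeP _ hG)/barE; exists y.
exists [set a | [&& bar a \in G, (\bot < a)%O & (a <= x)%O]]; split=> [a|].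
  rewrite inE => /and3P[aG a0 _]; split=> // y [y0 ya].
  case E: (divisors_in G (bar y)) => [|g s].
    suff : (y <= \bot)%O by rewrite lex0 => /eqP yb; rewrite yb ltxx in y0.
    rewrite barle barP E /lcm_seq big_nil.
    by apply/mnm_lepP => i; rewrite mnm0E.
  have: g \in divisors_in G (bar y) by rewrite E mem_head.
  rewrite mem_filter => /andP[gy gG].
  have ga : (g <= bar a)%MM by apply: lepm_trans gy _; rewrite -barle ltW.
  move: gy; rewrite (minimal_generators_antichain hG gG aG ga) -barle.
  by move=> /(lt_le_trans ya); rewrite ltxx.
apply/le_anti/andP; split; last first.
  by apply/joinsP => a; rewrite inE => /and3P[].
rewrite barle barP lcm_seq_le; apply/allP => g.
rewrite mem_filter => /andP[gx gG].
have [|a ag] := (barE g).1.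
  apply/(in_lcm_latticeP _ hG); have gg: {subset [:: g] <= G}.
    by move=> h; rewrite inE => /eqP->.
  have E: lcm_seq [:: g] = g by rewrite /lcm_seq big_cons big_nil mlcm0.
  by rewrite -{1 2}E lcm_divisors_inE.
rewrite -ag -barle; have [->|a0] := eqVneq a \bot%O; first exact: le0x.
by apply: joins_sup; rewrite inE ag gG lt0x a0 barle ag.
Qed.

(* Main.v *)
Require Import Defs.
From HB Require Import structures.
From mathcomp Require Import all_boot all_order all_algebra.
Import Order.TTheory GRing.Theory.
Local Open Scope ring_scope.

(** The theorem rests on the identity x(a) = bar a for every element a of P,
    proved one variable at a time.  Fix a variable i and let e p be the
    exponent of i in bar p.  Joins in P are lcms of monomials, so
    e (p \/ q) = max (e p) (e q), and for every threshold c the set of the p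
    with e p <= c has a largest element z c; in other words e is residuated,
    with e a <= c iff a <= z c.  The exponent of i in the label of p is
    min {e t : t > p} - e p, which is the number of thresholds c with
    e p <= c < e t for all t > p, that is, with z c = p.  Summing over the p
    that are not above a counts each threshold c below e \top such that
    a is not below z c, that is, such that c < e a; there are e a of them
    (residuated_gap_sum, atom_monomial_gcd_labeling).

    The atoms of the LCM lattice of a proper ideal are the minimal generators
    (atom_minimal_generator): an element other than \bot is divisible by a
    generator, no generator is 1, and generators form an antichain.  Hence the
    generators x(a) of the ideal of the labeling are those of M, the two
    ideals coincide, and bar itself is the isomorphism that makes the labeling
    a coordinatization. *)

(** * Gaps of a residuated function *)

Lemma ltn_bigminP (I : finType) (Q : pred I) (F : I -> nat) (x c : nat) :
  reflect ((c < x)%N /\ forall t, Q t -> (c < F t)%N)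
          (c < \big[minn/x]_(t | Q t) F t)%N.
Proof. exact: (@bigmin_gtP _ nat I x c Q F). Qed.

Lemma sum_nat_between (N lo hi : nat) : (hi <= N)%N ->
  (\sum_(0 <= c < N) ((lo <= c) && (c < hi)) = hi - lo)%N.
Proof.
move=> hiN; rewrite -[RHS]muln1 -sum_nat_const_nat.
rewrite [RHS](big_nat_widen _ _ _ _ _ hiN) [RHS](big_nat_widenl _ 0) //.
by rewrite [RHS]big_mkcond; apply: eq_bigr => c _; rewrite andbC /=; case: andP.
Qed.

(** The gap min {e t : t > p} - e p counts the thresholds c whose sublevel set
    {e <= c} has p as its largest element z c; each c < e \top is counted for
    exactly one p, which turns the sum over p into a sum over c. *)
Lemma residuated_gap_sum (d : Order.disp_t) (P : finTBLatticeType d)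
    (e : P -> nat) (z : nat -> P) (a : P) :
  (forall c p, (e p <= c)%N = (p <= z c)%O) ->
  (\sum_(p : P | ~~ (a <= p)%O)
     (\big[minn/e \top%O]_(t : P | (p < t)%O) e t - e p) = e a)%N.
Proof.
move=> ez.
have gapE p : (\big[minn/e \top%O]_(t : P | (p < t)%O) e t - e p =
    \sum_(0 <= c < e \top%O) (z c == p))%N.
  rewrite -(@sum_nat_between (e \top%O)); last first.
    by rewrite leqNgt; apply/negP => /ltn_bigminP[]; rewrite ltnn.
  apply: eq_big_nat => c /= cN; congr nat_of_bool; apply/andP/eqP.
    case=> epc /ltn_bigminP[_ gt_c]; apply/eqP; move: epc; rewrite ez.
    rewrite eq_sym le_eqVlt => /predU1P[->|/gt_c]; first by rewrite eqxx.
    by rewrite ltnNge ez lexx.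
  move=> <-; rewrite ez lexx; split=> //; apply/ltn_bigminP; split=> // t.
  by rewrite ltnNge ez => /lt_geF->.
under eq_bigr do rewrite gapE.
rewrite exchange_big /=.
transitivity (\sum_(0 <= c < e \top%O) ((0 <= c) && (c < e a)))%N; last first.
  rewrite sum_nat_between ?subn0 // ez; apply: le_trans (lex1 a) _.
  by rewrite -ez.
apply: eq_bigr => c _; rewrite ltnNge ez /=.
have [az|naz] := boolP (a <= z c)%O.
  apply: big1 => p nap; case: eqP => // zp.
  by rewrite -zp az in nap.
rewrite (bigD1 (z c)) //= eqxx big1 ?addn0 // => p /andP[_].
by rewrite eq_sym => /negPf->.
Qed.

(** Over a finite lattice, a monotone e that sends joins to maxima is
    residuated because each sublevel set is closed under joins, hence has its
    own join as largest element. *)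
Lemma join_max_residuated (d : Order.disp_t) (P : finTBLatticeType d)
    (e : P -> nat) :
  {homo e : p q / (p <= q)%O >-> (p <= q)%N} -> e \bot%O = 0%N ->
  (forall p q, (e (p `|` q)%O <= maxn (e p) (e q))%N) ->
  exists z : nat -> P, forall c p, (e p <= c)%N = (p <= z c)%O.
Proof.
move=> e_homo e0 eU.
exists (fun c => (\join_(p | (e p <= c)%N) p)%O) => c p.
apply/idP/idP => [epc|/e_homo pz]; first exact: joins_sup.
apply: leq_trans pz _; elim/big_ind: _ => // [|x y xc yc]; first by rewrite e0.
by apply: leq_trans (eU x y) _; rewrite geq_max xc.
Qed.

(** * LCM lattices *)

Section LcmLattice.
Variables (k : fieldType) (r : nat) (M : {mpoly k[r]} -> Prop).
Variable G : seq 'X_{1..r}.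
Variables (d : Order.disp_t) (P : finTBLatticeType d) (bar : P -> 'X_{1..r}).
Hypothesis G_minimal : minimal_generators M G.
Hypothesis P_bar : lcm_lattice_iso M bar.

Lemma lcm_lattice_seq S : {subset S <= G} -> exists p, bar p = lcm_seq S.
Proof. by move=> SG; case: P_bar => _ barE _; apply/barE; exists G, S. Qed.

Lemma lcm_lattice_divisors p : bar p = lcm_seq (divisors_in G (bar p)).
Proof.
by case: P_bar => _ barE _; apply/(in_lcm_latticeP _ G_minimal)/barE; exists p.
Qed.

Lemma lcm_lattice_le p q : (p <= q)%O = (bar p <= bar q)%MM.
Proof. by case: P_bar. Qed.

Lemma lcm_lattice_bot : bar \bot%O = 0%MM.
Proof.
have [//|p] := @lcm_lattice_seq [::]; rewrite /lcm_seq big_nil => p0.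
apply: lepm_anti; first by rewrite -p0 -lcm_lattice_le le0x.
by apply/mnm_lepP => i; rewrite mnm0E.
Qed.

Lemma lcm_lattice_join p q : (bar (p `|` q)%O <= mlcm (bar p) (bar q))%MM.
Proof.
have [|s sE] :=
  @lcm_lattice_seq (divisors_in G (bar p) ++ divisors_in G (bar q)).
  by move=> g; rewrite mem_cat !mem_filter => /orP[] /andP[].
(* s is an upper bound of p and q whose monomial still divides the lcm *)
apply: (@lepm_trans _ _ _ (bar s)); last first.
  rewrite sE lcm_seq_le all_cat; apply/andP; split; apply/allP => g;
    rewrite mem_filter => /andP[gle _]; apply: lepm_trans gle _.
  - exact: lem_mlcml.
  - exact: lem_mlcmr.
rewrite -lcm_lattice_le leUx !lcm_lattice_le.
by rewrite (lcm_lattice_divisors p) (lcm_lattice_divisors q) sE;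
  apply/andP; split; apply: lcm_seq_sub => g gD; rewrite mem_cat gD ?orbT.
Qed.

Lemma gcd_labelingE p i :
  gcd_labeling bar p i =
  (\big[minn/bar \top%O i]_(t : P | (p < t)%O) bar t i - bar p i)%N.
Proof.
rewrite mnmBE; congr (_ - _)%N.
by apply: (big_morph (fun m : 'X_{1..r} => m i)) => // x y; rewrite mnmE.
Qed.

(** In each variable the exponents in the labels are the gaps of a residuated
    function, so that the product of the labels of the p that are not above a
    telescopes to bar a. *)
Lemma atom_monomial_gcd_labeling a :
  atom_monomial (gcd_labeling bar) a = bar a.
Proof.
apply/mnmP => i; rewrite mnm_sumE.
have [p q|||z zP] := @join_max_residuated _ P (fun p => bar p i).
- by rewrite lcm_lattice_le => /mnm_lepP.
- by rewrite lcm_lattice_bot mnm0E.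
- move=> p q; have /mnm_lepP/(_ i) := lcm_lattice_join p q.
  by rewrite mlcmE mnmDE mnmBE -maxnE.
by under eq_bigr do rewrite gcd_labelingE; exact: residuated_gap_sum zP.
Qed.

(** This keeps \bot, whose monomial is 1, apart from the elements of the
    lattice that stand for generators. *)
Lemma generator_neq0 : ~ M 1 -> 0%MM \notin G.
Proof.
move=> M_proper; apply/negP => G0; apply: M_proper; case: G_minimal => _ MG _.
apply/MG; rewrite -mpolyX0; apply/ideal_gen_monomial; exists 0%MM => //.
exact: lepm_refl.
Qed.

Lemma generator_le_bar p : p != \bot%O -> exists2 g, g \in G & (g <= bar p)%MM.
Proof.
move=> p0; case E: (divisors_in G (bar p)) => [|g s]; last first.
  have: g \in divisors_in G (bar p) by rewrite E mem_head.
  by rewrite mem_filter => /andP[gp gG]; exists g.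
case/eqP: p0; case: P_bar => bar_inj _ _; apply: bar_inj.
by rewrite lcm_lattice_bot lcm_lattice_divisors E /lcm_seq big_nil.
Qed.

(** Below an element other than \bot there is a minimal generator, and minimal
    generators are pairwise incomparable: they are the minimal elements of
    P without \bot. *)
Lemma atom_minimal_generator x : ~ M 1 ->
  (exists a : P, atom a /\ x = bar a) <-> x \in G.
Proof.
move=> M_proper; have G0 := generator_neq0 M_proper.
have barG g : g \in G -> exists2 p, bar p = g & p != \bot%O.
  move=> gG; have [|p] := @lcm_lattice_seq [:: g].
    by move=> h; rewrite inE => /eqP->.
  rewrite /lcm_seq big_cons big_nil mlcm0 => pg; exists p => //.
  by apply: contraNneq G0 => p0; rewrite -lcm_lattice_bot -p0 pg.
split=> [[a [[a0 a_min] ->]]|xG].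
  have [|g gG ga] := @generator_le_bar a; first by rewrite -lt0x.
  have [s sg s0] := barG g gG.
  have : (s <= a)%O by rewrite lcm_lattice_le sg.
  rewrite le_eqVlt => /predU1P[<-|sa]; first by rewrite sg.
  by case: (a_min s); rewrite lt0x.
have [a ax a0] := barG x xG; exists a; split=> //; split; first by rewrite lt0x.
move=> y [y0 ya]; have [|g gG gy] := @generator_le_bar y; first by rewrite -lt0x.
have gx : (g <= x)%MM.
  by apply: lepm_trans gy _; rewrite -ax -lcm_lattice_le ltW.
have ay : (a <= y)%O.
  by rewrite lcm_lattice_le ax -(minimal_generators_antichain G_minimal gG xG gx).
by have := lt_le_trans ya ay; rewrite ltxx.
Qed.

End LcmLattice.

(** * Ideals that contain the same polynomials *)

Lemma ideal_gen_eq (k : fieldType) (r : nat) (S T : 'X_{1..r} -> Prop) :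
  (forall x, S x <-> T x) -> same_ideal (@ideal_gen k r S) (ideal_gen T).
Proof.
move=> ST f; split; apply: ideal_gen_sub => s Ss; exists s;
  by [apply/ST | exact: lepm_refl].
Qed.

Lemma minimal_generators_same_ideal (k : fieldType) (r : nat)
    (I J : {mpoly k[r]} -> Prop) (G : seq 'X_{1..r}) :
  same_ideal I J -> minimal_generators I G -> minimal_generators J G.
Proof.
move=> IJ [uG IG G_min]; split=> // [f|g gG JG].
  by split=> [/IJ/IG|/IG/IJ].
by apply: (G_min g gG) => f; split=> [/IJ/JG|/JG/IJ].
Qed.

Lemma lcm_lattice_iso_same_ideal (k : fieldType) (r : nat)
    (I J : {mpoly k[r]} -> Prop) (d : Order.disp_t) (P : finTBLatticeType d)
    (bar : P -> 'X_{1..r}) :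
  same_ideal I J -> lcm_lattice_iso I bar -> lcm_lattice_iso J bar.
Proof.
move=> IJ [bar_inj barE bar_le]; split=> // m; rewrite -barE.
have JI f : J f <-> I f by split=> /IJ.
split=> -[H [S [Hmin SH mE]]]; exists H, S; split=> //.
- exact: minimal_generators_same_ideal _ _ _ _ _ JI Hmin.
- exact: minimal_generators_same_ideal _ _ _ _ _ IJ Hmin.
Qed.

(** * The labeling by gcds *)

Theorem proposition3p4 (k : fieldType) (r n : nat)
    (M : {mpoly k[r]} -> Prop) (G : n.-tuple 'X_{1..r})
    (d : Order.disp_t) (P : finTBLatticeType d) (bar : P -> 'X_{1..r})
    (M_monomial : monomial_ideal M) (M_proper : ~ M 1)
    (G_minimal : minimal_generators M G)
    (P_atomic : atomic_lattice P) (P_bar : lcm_lattice_iso M bar) :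
  coordinatization k (gcd_labeling bar) /\
  same_ideal (labeling_ideal (gcd_labeling bar)) M.
Proof.
have same : same_ideal (labeling_ideal (gcd_labeling bar)) M.
  have atomE x : (exists a, atom a /\ x = atom_monomial (gcd_labeling bar) a)
      <-> x \in val G.
    rewrite -(@atom_minimal_generator _ _ _ _ _ _ _ G_minimal P_bar x M_proper).
    by split=> -[a [a_atom ->]]; exists a; split=> //;
      rewrite (@atom_monomial_gcd_labeling _ _ _ _ _ _ _ G_minimal P_bar).
  have gen_eq := @ideal_gen_eq k _ _ _ atomE.
  case: (G_minimal) => _ MG _ f.
  by split=> [/gen_eq/MG|/MG/gen_eq].
split=> //; exists bar.
by apply: lcm_lattice_iso_same_ideal _ P_bar => f; split=> /same.
Qed.
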